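(* There exists a constant $c$ depending only on $d$, such that for every finite family $\mathcal{F}$ of axis-parallel boxes in $\mathbb{R}^d$ in which every two intersecting boxes intersect at a corner we have $\tau(\mathcal{F}) \leq c\,\nu(\mathcal{F})\log\log(\nu(\mathcal{F}))$.
   Context: An axis-parallel box in $\mathbb{R}^d$ is a product of closed intervals $[x_1,y_1]\times\dots\times[x_d,y_d]$; a corner of a box is a zero-dimensional face of it. Two boxes in $\mathbb{R}^d$ intersect at a corner if one of them contains a corner of the other. For a family $\mathcal{F}$ of boxes, $\nu(\mathcal{F})$ (the matching number) is the maximum size of a subfamily of pairwise disjoint boxes, and $\tau(\mathcal{F})$ (the covering number) is the minimum size of a set of points in $\mathbb{R}^d$ that intersects every box in $\mathcal{F}$. Here $\log=\log_2$.
   Formalization: log log ν is read as log log max(ν,3): the literal bound fails at ν=2 (two disjoint boxes have τ=2 but log log 2=0) and is undefined for ν≤1; it is unchanged for ν≥3. *)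

(* Defs.v *)
From HB Require Import structures.
From mathcomp Require Import all_boot all_order all_algebra finmap.
From mathcomp Require Import boolp classical_sets reals exp.

Set Implicit Arguments.
Unset Strict Implicit.
Unset Printing Implicit Defensive.

Import Order.TTheory GRing.Theory Num.Theory.

Local Open Scope fset_scope.
Local Open Scope classical_set_scope.
Local Open Scope ring_scope.

(* Sides of length 0 are allowed, empty boxes are not. *)
Record box (R : realType) (d : nat) := Box {
  lo : 'rV[R]_d;
  hi : 'rV[R]_d;
  lo_le_hi : forall k, lo 0 k <= hi 0 k
}.

Definition box_set (R : realType) (d : nat) (b : box R d) : set 'rV[R]_d :=
  [set p | forall k, lo b 0 k <= p 0 k <= hi b 0 k].

Definition corners (R : realType) (d : nat) (b : box R d) : set 'rV[R]_d :=
  [set p | forall k, p 0 k = lo b 0 k \/ p 0 k = hi b 0 k].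

Definition intersect_at_corner (R : realType) (d : nat) (a b : box R d) : Prop :=
  (box_set a `&` corners b !=set0) \/ (box_set b `&` corners a !=set0).

(* A finite family of boxes is a map F : I -> box R d with I a finite type.
   Boxes may be repeated; as boxes are nonempty, repetitions change neither the
   matching number nor the covering number. *)

Definition matching (R : realType) (d : nat) (I : finType) (F : I -> box R d)
    (S : {set I}) : Prop :=
  trivIset [set` S] (fun i => box_set (F i)).

Definition matching_number (R : realType) (d : nat) (I : finType)
    (F : I -> box R d) : nat :=
  (\max_(S : {set I} | `[< matching F S >]) #|S|)%N.

Definition cover_by (R : realType) (d : nat) (I : finType) (F : I -> box R d)
    (P : {fset 'rV[R]_d}) : Prop :=
  forall i, [set` P] `&` box_set (F i) !=set0.

Lemma cover_by_exists (R : realType) (d : nat) (I : finType) (F : I -> box R d) :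
  exists n, `[< exists P : {fset 'rV[R]_d}, cover_by F P /\ #|` P| = n >].
Proof.
pose P : {fset 'rV[R]_d} := [fset lo (F i) | i in I].
exists #|` P|; apply/asboolP; exists P; split=> // i.
exists (lo (F i)); split; first by apply/imfsetP; exists i.
by move=> k; rewrite lexx lo_le_hi.
Qed.

Definition covering_number (R : realType) (d : nat) (I : finType)
    (F : I -> box R d) : nat :=
  ex_minn (cover_by_exists F).

Definition log2 (R : realType) (x : R) : R := ln x / ln 2.

(* The iterated logarithm is not positive (or not defined) at n = 0, 1, 2, where
   a bound of the form c * n * log log n can only be meant up to a constant; its
   argument is therefore replaced by 3 for n < 3, and nothing changes for
   n >= 3. *)
Definition loglog (R : realType) (n : nat) : R := log2 (log2 (maxn n 3)%:R).

(* Main.v *)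
Require Import Defs.
From mathcomp Require Import finmap boolp classical_sets reals exp.
From mathcomp Require Import all_boot all_order all_algebra.
From mathcomp Require Import zify.

Import Order.TTheory GRing.Theory Num.Theory.
Local Open Scope ring_scope.

(** Write [nu] for the matching number.  The bound comes from two independent
    facts.

    First, the fractional covering number is [O(nu)].  When intersecting boxes
    meet at corners, for every weighting of the boxes some corner lies in boxes
    of total weight at least a [1/(2 ^ d.+1 * nu)] share of the whole
    ([heavy_point]): otherwise the intersection graph would be so sparse that a
    greedy choice yields more than [nu] disjoint boxes
    ([weighted_independent_set]).  A multiplicative weights process turns these
    heavy points into one multiset of points of which every box contains a
    [1/r] share, with [r = 2 ^ d.+3 * nu] ([multiplicative_weights]).

    Second, boxes that contain a [1/r] share of a finite multiset of points of
    the [d]-dimensional space can be pierced by [O(r log log r)] points, a weak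
    net in the sense of Ezra ([weak_box_net]).  Binary search trees on the
    coordinates cut the points into cells in [(log r) ^ d] ways, such that every
    box in question has all its points in one cell whose center it contains.
    Cells with very many points are few, and their centers are taken.  The
    remaining cells contain so few points that only [r * (log r) ^ O(1)] boxes
    matter up to a factor 2 in the number of points; a greedy choice of
    [O(r log log r)] points pierces all but [r] of those.

    All counting is done in the natural numbers: a share [1/r] of [X] is a set
    [B] with [#|X| <= r * #|B|].  Logarithms appear as exponents [L], [e] with
    [r < 2 ^ L] and so on, and are compared with [loglog] only at the end. *)

(** * Halving by repeated proportional gains *)

(** The inequality (1 - 1/K) ^ K <= 1/2, raised to the power [e] and cleared of
    denominators, so that both greedy processes below stay in the natural
    numbers. *)
Lemma expn_halving (K e : nat) : (0 < K)%N ->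
  (2 ^ e * K.-1 ^ (K * e) <= K ^ (K * e))%N.
Proof.
case: K => // k _ /=.
(* Bernoulli's inequality (1 + 1/k) ^ n >= 1 + n/k. *)
have bernoulli n : (k ^ n * (k + n) <= k * k.+1 ^ n)%N.
  elim: n => [|n IHn]; first by rewrite !expn0; lia.
  have := leq_mul IHn (leqnn k.+1); rewrite !expnS.
  by move: (k ^ n)%N (k.+1 ^ n)%N => a b; nia.
have half : (2 * k ^ k.+1 <= k.+1 ^ k.+1)%N.
  case: (posnP k) => [-> //|k_gt0]; rewrite -(leq_pmul2l k_gt0).
  by apply: leq_trans (bernoulli k.+1); nia.
by case: e => [|e]; rewrite ?muln0 // !expnM -expnMn leq_exp2r.
Qed.

Lemma averaging (X : finType) (f : X -> nat) (a K : nat) :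
  (0 < #|X|)%N -> (#|X| * a <= K * \sum_i f i)%N ->
  exists i, (a <= K * f i)%N.
Proof.
move=> X_gt0 f_big; apply/existsP; apply: contraLR f_big.
rewrite negb_exists -ltnNge => /forallP small.
rewrite big_distrr /= -sum_nat_const.
have [x _] := card_gt0P X_gt0.
rewrite (bigD1 x) // [X in (_ < X)%N](bigD1 x) //= -addSn leq_add //.
  by rewrite ltnNge small.
by apply: leq_sum => i _; apply: ltnW; rewrite ltnNge small.
Qed.

(** If each set of a family holds a [1/K] share of the points, some point lies in
    a [1/K] share of the sets not yet hit.  Choosing such points greedily shrinks
    the unhit part by [1 - 1/K] at each step, hence halves it every [K] steps. *)
Lemma greedy_hitting (X : finType) (H : {set {set X}}) (K e : nat) :
    (0 < #|X|)%N -> (0 < K)%N -> (forall C, C \in H -> (#|X| <= K * #|C|)%N) ->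
  exists S : {set X}, (#|S| <= K * e)%N /\
    (2 ^ e * #|[set C in H | C :&: S == set0]| <= #|H|)%N.
Proof.
move=> X_gt0 K_gt0 H_big.
pose missed (S : {set X}) := [set C in H | C :&: S == set0].
have step (S : {set X}) : exists i,
    (K * #|missed (i |: S)| <= K.-1 * #|missed S|)%N.
  have [|i i_good] := @averaging X
      (fun i => #|[set C in missed S | i \in C]|) #|missed S| K X_gt0.
    under eq_bigr do rewrite -sum1_card big_mkcond /=.
    rewrite exchange_big /= big_distrr /= mulnC -sum_nat_const big_mkcond.
    apply: leq_sum => C _; case: ifP => // CS.
    have /H_big : C \in H by move: CS; rewrite inE => /andP[].
    move=> /leq_trans; apply; rewrite leq_mul2l -sum1_card big_mkcond /=.
    apply/orP; right; apply: leq_sum => i _.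
    have -> : (if C \in [set C' in missed S | i \in C'] then 1 else 0) = (i \in C : nat).
      by rewrite inE CS; case: (i \in C).
    by case: (i \in C).
  exists i.
  have -> : missed (i |: S) = missed S :\: [set C in missed S | i \in C].
    apply/setP=> C; rewrite !inE; case: (C \in H); rewrite ?andbF //=.
    rewrite setIUr setU_eq0; case: (_ :&: S == _); rewrite ?andbF //=.
    by rewrite !andbT setI_eq0 disjoint_sym disjoints1.
  have sub : [set C in missed S | i \in C] \subset missed S.
    by apply/subsetP=> C; rewrite inE => /andP[].
  rewrite cardsD (setIidPr sub).
  by case: (K) i_good K_gt0 => //= k; nia.
have iter t : exists S : {set X}, (#|S| <= t)%N /\
    (K ^ t * #|missed S| <= K.-1 ^ t * #|H|)%N.
  elim: t => [|t [S [S_small missS]]].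
    exists set0; rewrite cards0 !expn0 !mul1n; split=> //.
    by apply: subset_leq_card; apply/subsetP=> C; rewrite inE => /andP[].
  have [i Hi] := step S; exists (i |: S); split.
    by rewrite cardsU1; case: (_ \notin _) => /=; lia.
  rewrite !expnS; move: Hi missS; set a := #|missed _|; set b := #|missed S|.
  by move: (K ^ t)%N (K.-1 ^ t)%N => u v; nia.
have [S [S_small missS]] := iter (K * e)%N.
exists S; split=> //; rewrite -/(missed S).
have u_gt0 : (0 < K ^ (K * e))%N by rewrite expn_gt0 K_gt0.
rewrite -(leq_pmul2l u_gt0).
have := leq_mul (expn_halving K e K_gt0) (leqnn #|H|).
have := leq_mul (leqnn (2 ^ e)) missS.
move: (K ^ _)%N (K.-1 ^ _)%N (2 ^ e)%N => u v w; nia.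
Qed.

(** A primal-dual argument in place of linear programming duality: if every
    weighting of [I] admits a point whose hits carry a [1/K] share of the
    weight, then in some multiset of points a [1/(4K)] share hits any given element
    of [I].  The points are chosen one after the other, each heavy for the
    current weights, and the weight of an element is halved whenever it is hit.  The
    total weight then decays like [(1 - 1/(2K)) ^ T], and it dominates [2 ^ -N]
    for an element hit [N] times only, which bounds [N] from below.  The threshold
    [#|I| <= m] absorbs the initial total weight [#|I|]. *)
Lemma multiplicative_weights (P : Type) (I : finType) (hit : P -> I -> bool)
    (K m : nat) :
    (0 < K)%N -> (#|I| <= m)%N ->
    (forall w : I -> nat, exists p,
       (\sum_i w i <= K * \sum_(i | hit p i) w i)%N) ->
  exists x : 'I_(4 * K * m) -> P,
    forall i, (m <= #|[set t | hit (x t) i]|)%N.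
Proof.
move=> K_gt0 I_le_m heavy_point.
pose N (s : seq P) i := count (hit^~ i) s.
(* The weights are scaled by [2 ^ T] to keep them integral. *)
have iter T : exists s : seq P, size s = T /\
    ((2 * K) ^ T * \sum_i 2 ^ (T - N s i) <= (2 * (2 * K).-1) ^ T * #|I|)%N.
  elim: T => [|T [s [sizes IH]]].
    by exists [::]; rewrite !expn0 !mul1n sum_nat_const muln1.
  have [p p_heavy] := heavy_point (fun i => 2 ^ (T - N s i))%N.
  exists (p :: s); split; first by rewrite /= sizes.
  have -> : (\sum_i 2 ^ (T.+1 - N (p :: s) i) =
     \sum_i 2 ^ (T - N s i) + \sum_(i | ~~ hit p i) 2 ^ (T - N s i))%N.
    rewrite [X in (_ = _ + X)%N]big_mkcond /= -big_split; apply: eq_bigr => i _.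
    rewrite /N /=; case: (hit p i) => /=; first by rewrite addn0.
    by rewrite add0n subSn ?expnS ?mul2n ?addnn // -sizes count_size.
  have E : (\sum_i 2 ^ (T - N s i) = \sum_(i | hit p i) 2 ^ (T - N s i) +
      \sum_(i | ~~ hit p i) 2 ^ (T - N s i))%N by rewrite (bigID (hit p)).
  move: p_heavy IH; rewrite E !expnS.
  move: (\sum_(i | hit p i) _)%N (\sum_(i | ~~ hit p i) _)%N => a b.
  move: ((2 * K) ^ T)%N ((2 * (2 * K).-1) ^ T)%N => u v p_heavy IH.
  have [k Ek] : exists k, (2 * K = k.+1)%N by exists (2 * K).-1; lia.
  rewrite Ek /= in IH *.
  have Eka : (2 * (K * a) = k.+1 * a)%N by rewrite mulnA Ek.
  have key : (k.+1 * (a + b + b) <= 2 * k * (a + b))%N by lia.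
  have := leq_mul (leqnn (2 * k)) IH.
  have := leq_mul key (leqnn u); lia.
have [s [sizes H]] := iter (4 * K * m)%N.
pose x (t : 'I_(4 * K * m)) := tnth (in_tuple s) (cast_ord (esym sizes) t).
exists x => i.
have -> : #|[set t | hit (x t) i]| = N s i.
  rewrite /N -sum1_count -(big_map id (hit^~ i) (fun=> 1%N)) map_id.
  rewrite [RHS]big_tnth -sum1_card (reindex (cast_ord (esym sizes))) /=.
    by apply: eq_bigl => t; rewrite inE.
  by exists (cast_ord sizes) => t _; rewrite ?cast_ordK ?cast_ordKV.
have NT : (N s i <= 4 * K * m)%N by rewrite -sizes count_size.
have wi : (2 ^ (4 * K * m - N s i) <= \sum_i 2 ^ (4 * K * m - N s i))%N.
  by rewrite (bigD1 i) //= leq_addr.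
have {H} := leq_trans (leq_mul (leqnn _) wi) H.
have := @expn_halving (2 * K) (2 * m) ltac:(lia).
have -> : (2 * K * (2 * m) = 4 * K * m)%N by lia.
rewrite [X in (_ <= X * _)%N -> _]expnMn => H1 H2.
have ET : (2 ^ (4 * K * m) = 2 ^ N s i * 2 ^ (4 * K * m - N s i))%N.
  by rewrite -expnD subnKC.
have Ilt : (#|I| < 2 ^ #|I|)%N by rewrite ltn_expl.
have : (2 ^ (2 * m) <= 2 ^ (N s i + #|I|))%N.
  rewrite expnD; rewrite ET in H2; move: H1 H2.
  have : (0 < 2 ^ (4 * K * m - N s i))%N by rewrite expn_gt0.
  have : (0 < (2 * K) ^ (4 * K * m))%N by rewrite expn_gt0; lia.
  move: Ilt; set a := (2 ^ (2 * m))%N; set u := (_.-1 ^ _)%N; set n := (2 ^ N s i)%N.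
  set z := (2 ^ (_ - _))%N; set c := (_ ^ (4 * _ * _))%N; set I2 := (2 ^ #|I|)%N.
  clearbody a u n z c I2; move=> Ilt c_gt0 z_gt0 H1 H2.
  rewrite -(leq_pmul2l c_gt0) -(leq_pmul2l z_gt0).
  have : (c * z * a <= n * z * (a * u) * #|I|)%N by nia.
  have : (n * z * (a * u) * #|I| <= n * z * c * I2)%N.
    by rewrite leq_mul ?(ltnW Ilt) // leq_mul.
  lia.
rewrite leq_exp2l //; lia.
Qed.

(** * A point of large weight *)

(** A hereditary bound on the total weight of adjacent pairs plays the part of a
    degeneracy bound: by averaging, a [J] of positive weight contains a vertex
    whose closed neighbourhood weighs at most [K].  Picking it and discarding
    its neighbourhood costs at most [K] per vertex of the independent set. *)
Lemma weighted_independent_set (I : finType) (w : I -> nat) (e : rel I) (K : nat) :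
    reflexive e -> symmetric e ->
    (forall J : {set I}, \sum_(i in J) \sum_(j in J | e i j) w i * w j
       <= K * \sum_(i in J) w i)%N ->
  forall J : {set I}, exists S : {set I},
    [/\ S \subset J, {in S &, forall i j, i != j -> ~~ e i j} &
        (\sum_(i in J) w i <= K * #|S|)%N].
Proof.
move=> e_refl e_sym e_sparse J.
elim: {J}_.+1 {-2}J (ltnSn #|J|) => // n IHn J J_small.
case: (posnP (\sum_(i in J) w i)%N) => [-> | wJ_gt0].
  by exists set0; split; rewrite ?sub0set // => i j; rewrite inE.
have [i iJ i_light] : exists2 i, i \in J & (\sum_(j in J | e i j) w j <= K)%N.
  apply/exists_inP; apply: contraT; rewrite negb_exists_in => /forall_inP big.
  suff : (K * \sum_(i in J) w i < \sum_(i in J) \sum_(j in J | e i j) w i * w j)%N.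
    by rewrite ltnNge e_sparse.
  have [i0 i0J wi0] : exists2 i0, i0 \in J & (0 < w i0)%N.
    apply/exists_inP; apply: contraTT wJ_gt0; rewrite negb_exists_in => /forall_inP w0.
    by rewrite -leqNgt leqn0 sum_nat_eq0; apply/forall_inP=> i /w0; rewrite -eqn0Ngt.
  rewrite big_distrr /= (bigD1 i0) // [X in (_ < X)%N](bigD1 i0) //= -addSn leq_add //.
    rewrite -big_distrr /= mulnC ltn_pmul2l // ltnNge; exact: big.
  apply: leq_sum => i /andP[iJ _]; rewrite -big_distrr /= mulnC leq_mul //.
  by apply: ltnW; rewrite ltnNge; exact: big.
pose J' := [set j in J | ~~ e i j].
have J'J : J' \subset J by apply/subsetP=> j; rewrite inE => /andP[].
have [|S [SJ' S_indep wJ']] := IHn J'.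
  apply: leq_trans (_ : #|J| <= n)%N => //; apply: proper_card; rewrite properE J'J /=.
  by apply/subsetPn; exists i; rewrite // inE e_refl andbF.
have Si j : j \in S -> ~~ e i j by move/(subsetP SJ'); rewrite inE => /andP[].
have iS : i \notin S by apply/negP=> /Si; rewrite e_refl.
exists (i |: S); split.
- by rewrite subUset sub1set iJ (subset_trans SJ').
- move=> j k; rewrite !inE => /orP[/eqP->|jS] /orP[/eqP->|kS]; rewrite ?eqxx //.
  + by move=> _; exact: Si.
  + by move=> _; rewrite e_sym; exact: Si.
  + exact: S_indep.
rewrite cardsU1 iS mulnDr muln1 (bigID (e i)) /= leq_add //.
by apply: leq_trans wJ'; rewrite [X in (_ <= X)%N](eq_bigl _ _ (fun j => in_set _ j)).
Qed.

Definition inbox {R : realType} {d : nat} (b : box R d) (p : 'rV[R]_d) : bool :=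
  [forall k, lo b 0 k <= p 0 k <= hi b 0 k].

Lemma inboxP {R : realType} {d : nat} (b : box R d) (p : 'rV[R]_d) :
  reflect (box_set b p) (inbox b p).
Proof. exact: forallP. Qed.

Definition corner {R : realType} {d : nat} (b : box R d) (e : {ffun 'I_d -> bool}) :
  'rV[R]_d := \row_k (if e k then hi b 0 k else lo b 0 k).

Lemma inbox_corner {R : realType} {d : nat} (b : box R d) e : inbox b (corner b e).
Proof. by apply/forallP=> k; rewrite mxE; case: (e k); rewrite lexx ?andbT ?lo_le_hi. Qed.

Lemma cornersE {R : realType} {d : nat} (b : box R d) p :
  corners b p -> exists e, p = corner b e.
Proof.
move=> bp; exists [ffun k => p 0 k == hi b 0 k]; apply/rowP=> k; rewrite mxE ffunE.
by case: eqP => // ?; case: (bp k).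
Qed.

(** The only use of the hypothesis on corners.  Let [D] be the largest weight of
    the boxes that contain a given corner.  Every intersecting pair is
    witnessed by a corner of one box inside the other, so, charging a pair to
    that corner, the intersection graph has total pair weight at most
    [2 * 2 ^ d * D] times the weight of the boxes, and the same holds for every
    subfamily.  An independent set of the intersection graph is a matching, so
    the total weight is at most [2 ^ d.+1 * D * nu]. *)
Lemma heavy_point (R : realType) (d : nat) (I : finType) (F : I -> box R d) :
    (forall i j : I, i != j -> (box_set (F i) `&` box_set (F j) !=set0)%classic ->
       intersect_at_corner (F i) (F j)) ->
  forall w : I -> nat, exists p, (\sum_i w i <=
    2 ^ d.+1 * matching_number F * \sum_(i | inbox (F i) p) w i)%N.
Proof.
move=> F_corner w.
pose D := (\max_i \max_e \sum_(j | inbox (F j) (corner (F i) e)) w j)%N.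
pose meets i j := `[< (box_set (F i) `&` box_set (F j) !=set0)%classic >].
have meets_refl : reflexive meets.
  by move=> i; apply/asboolP; exists (lo (F i)); split=> k; rewrite lexx lo_le_hi.
have meets_sym : symmetric meets by move=> i j; rewrite /meets classical_sets.setIC.
pose incid i j := (\sum_e (inbox (F i) (corner (F j) e) : nat))%N.
(* [incid i j] counts the corners of [F j] inside [F i]. *)
have meets_incid i j : meets i j -> (1 <= incid i j + incid j i)%N.
  have incid_gt0 i' j' e : inbox (F i') (corner (F j') e) -> (0 < incid i' j')%N.
    by move=> inc; rewrite /incid (bigD1 e) //= inc.
  move=> /asboolP meets_ij.
  have [<-|ij] := eqVneq i j.
    by rewrite ltn_addr // (@incid_gt0 _ _ [ffun=> true]) ?inbox_corner.
  have [[p [/inboxP pi /cornersE[e pe]]]|[p [/inboxP pj /cornersE[e pe]]]]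
    := F_corner i j ij meets_ij.
    by rewrite ltn_addr // (@incid_gt0 _ _ e) -?pe.
  by rewrite ltn_addl // (@incid_gt0 _ _ e) -?pe.
have sparse (J : {set I}) : (\sum_(i in J) \sum_(j in J | meets i j) w i * w j
       <= (2 ^ d.+1 * D) * \sum_(i in J) w i)%N.
  have half : (\sum_(i in J) \sum_(j in J) w i * w j * incid j i
               <= 2 ^ d * D * \sum_(i in J) w i)%N.
    rewrite big_distrr /=; apply: leq_sum => i iJ.
    under eq_bigr do rewrite big_distrr /=.
    rewrite exchange_big /=.
    have -> : (2 ^ d * D * w i = \sum_(e : {ffun 'I_d -> bool}) D * w i)%N.
      by rewrite sum_nat_const card_ffun card_bool card_ord mulnA.
    apply: leq_sum => e _.
    under eq_bigr do rewrite -mulnA.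
    rewrite -big_distrr /= mulnC leq_mul //.
    apply: leq_trans (leq_bigmax i); apply: leq_trans (leq_bigmax e).
    rewrite big_mkcond [X in (_ <= X)%N]big_mkcond; apply: leq_sum => j _.
    by case: (_ \in _); case: inbox; rewrite ?muln1 ?muln0.
  apply: (@leq_trans (\sum_(i in J) \sum_(j in J)
                        (w i * w j * incid j i + w i * w j * incid i j))).
    apply: leq_sum => i _; rewrite big_mkcondr; apply: leq_sum => j _.
    by case: ifP => // /meets_incid inc; rewrite -mulnDr addnC leq_pmulr.
  under eq_bigr do rewrite big_split /=.
  rewrite big_split /= [X in (_ + X)%N]exchange_big /=.
  under [X in (_ + X)%N]eq_bigr do under eq_bigr do rewrite [(w _ * w _)%N]mulnC.
  by rewrite expnS; lia.
have [S [_ S_indep wS]] :=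
  weighted_independent_set _ _ _ _ meets_refl meets_sym sparse setT.
have S_matching : (#|S| <= matching_number F)%N.
  rewrite /matching_number; apply: (leq_bigmax_cond S) .
  apply/asboolP=> i j /= iS jS ij0; apply/eqP; apply: contraT => ij.
  by have /negP := S_indep i j iS jS ij; case; apply/asboolP.
case: (posnP #|I|) => [I0|/card_gt0P[i0 _]].
  exists 0; rewrite big_pred0 // => i; by have := card0_eq I0 i; rewrite inE.
have I_gt0 : (0 < #|I|)%N by apply/card_gt0P; exists i0.
have E_gt0 : (0 < #|{: {ffun 'I_d -> bool}}|)%N by apply/card_gt0P; exists [ffun=> true].
pose wc i (e : {ffun 'I_d -> bool}) := (\sum_(j | inbox (F j) (corner (F i) e)) w j)%N.
have [i1 D1] := bigop.eq_bigmax (fun i => \max_e wc i e)%N I_gt0.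
have [e1 E1] := bigop.eq_bigmax (wc i1) E_gt0.
exists (corner (F i1) e1); rewrite -/(wc i1 e1) -E1 -D1 -/D.
move: wS; under eq_bigl do rewrite inE.
move=> /leq_trans; apply.
by rewrite mulnAC leq_mul // leq_mul.
Qed.

(** * Quantiles and cells on the line *)

Definition order_convex {R : realType} (P : pred R) : Prop :=
  forall s t u, s <= t <= u -> P s -> P u -> P t.

(** The sequence [q] splits the values of [y] on [A] into blocks of about [g]
    points, in the sense that a convex set that misses [q] contains less than [g] of
    them.  This form avoids ranks, and so any discussion of repeated values. *)
Definition quantiles {R : realType} {X : finType} (y : X -> R) (A : {set X})
    (g : nat) (q : seq R) : Prop :=
  [/\ (size q * g <= #|A|)%N, sorted <=%R q &
      forall P, order_convex P -> (g <= #|[set i in A | P (y i)]|)%N -> has P q].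

(** The first quantile is the least value [y i0] with at least [g] points at or
    below it; the others come from the points above [y i0]. *)
Lemma quantiles_exist {R : realType} {X : finType} (y : X -> R) (A : {set X}) (g : nat) :
  (0 < g)%N -> exists q, quantiles y A g q.
Proof.
move=> g_gt0.
(* That the quantiles are values of [y] on [A] makes the recursive ones exceed
   the first one, which keeps the sequence sorted. *)
suff [q [sub_q q_quant]] : exists q, all (fun t => [exists i in A, t == y i]) q /\
  quantiles y A g q by exists q.
elim: {A}_.+1 {-2}A (ltnSn #|A|) => // n IHn A A_small.
have PA P : (#|[set i in A | P (y i)]| <= #|A|)%N.
  by apply: subset_leq_card; apply/subsetP=> i; rewrite inE => /andP[].
case: (ltnP #|A| g) => [A_lt_g|g_le_A].
  exists [::]; split=> //; split=> // P _ /leq_trans/(_ (PA P)); lia.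
pose below t := [set j in A | y j <= t].
have max_in (B : {set X}) : (0 < #|B|)%N ->
    exists2 i, i \in B & forall j, j \in B -> y j <= y i.
  by case/card_gt0P=> i0 i0B; case: (arg_maxP y i0B) => i iB imax; exists i.
have [i1 i1A i1_max] := max_in A (leq_trans g_gt0 g_le_A).
pose ok i := (i \in A) && (g <= #|below (y i)|)%N.
have ok1 : ok i1.
  rewrite /ok i1A (leq_trans g_le_A) //; apply: subset_leq_card.
  by apply/subsetP=> j jA; rewrite inE jA i1_max.
case: (arg_minP y ok1) => i0 /andP[i0A i0_g] i0_min.
pose A' := [set j in A | y i0 < y j].
have A'E : (#|A'| + #|below (y i0)| = #|A|)%N.
  rewrite -(cardsID [set j | y i0 < y j] A); congr (_ + _)%N.
    by apply: eq_card => j; rewrite !inE.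
  by apply: eq_card => j; rewrite !inE -leNgt andbC.
have [|q [q_sub [q_size q_sorted q_hit]]] := IHn A'; first by lia.
have q_gt : all (fun t => y i0 < t) q.
  apply: sub_all q_sub => t /exists_inP[j]; rewrite inE => /andP[_ lt] /eqP->.
  exact: lt.
exists (y i0 :: q); split=> /=.
  apply/andP; split; first by apply/exists_inP; exists i0.
  apply: sub_all q_sub => t /exists_inP[j]; rewrite inE => /andP[jA _] tj.
  by apply/exists_inP; exists j.
split=> [|/=|P P_conv P_big].
- by rewrite /= mulSn; lia.
- by rewrite path_min_sorted //; apply: sub_all q_gt => t /ltW.
rewrite /=; case Pi0 : (P (y i0)) => //=.
have [/existsP[j /and3P[jA Pj lt_j]]|none] :=
    boolP [exists j, [&& j \in A, P (y j) & y i0 < y j]].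
  apply: q_hit => //; apply: leq_trans P_big _; apply: subset_leq_card.
  apply/subsetP=> k; rewrite !inE => /andP[kA Pk]; rewrite kA Pk andbT /=.
  rewrite ltNge; apply/negP=> le_k; move: Pi0.
  by rewrite (P_conv (y k) _ (y j)) // le_k ltW.
have [k] := max_in [set i in A | P (y i)] (leq_trans g_gt0 P_big).
rewrite inE => /andP[kA Pk] k_max.
have /i0_min le0k : ok k.
  rewrite /ok kA; apply: leq_trans P_big _; apply: subset_leq_card.
  by apply/subsetP=> j jP; rewrite inE k_max // andbT; move: jP; rewrite inE => /andP[].
case/negP: none; apply/existsP; exists k; rewrite kA Pk lt_neqAle le0k andbT /=.
by apply/eqP=> E; rewrite E Pk in Pi0.
Qed.

(** Shrinking [l, h] to the extreme quantiles that it contains loses less than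
    [g] points on either side, since the two pieces cut off contain no
    quantile. *)
Lemma quantiles_shrink {R : realType} {X : finType} (y : X -> R) (A : {set X})
    (g : nat) (q : seq R) (l h : R) :
    quantiles y A g q -> (0 < g)%N -> (g <= #|[set i in A | (l <= y i <= h)%R]|)%N ->
  exists a b : 'I_(size q),
    [/\ l <= q`_a, q`_b <= h,
        (#|[set i in A | (l <= y i < q`_a)%R]| < g)%N &
        (#|[set i in A | (q`_b < y i <= h)%R]| < g)%N].
Proof.
move=> [_ _ q_hit] g_gt0 big_lh.
pose P (t : R) := l <= t <= h.
have {}q_hit (Q : pred R) : order_convex Q -> (g <= #|[set i in A | Q (y i)]|)%N ->
    exists m : 'I_(size q), Q q`_m.
  move=> Q_conv /(q_hit Q Q_conv)/hasP[t /(nthP 0)[m m_lt <-] Qm].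
  by exists (Ordinal m_lt).
have [|a0 Pa0] := q_hit P _ big_lh.
  move=> s t u /andP[st tu] /andP[ls _] /andP[_ uh].
  by rewrite /P (le_trans ls) // (le_trans tu).
case: (@arg_minP _ _ _ a0 (fun a : 'I_(size q) => P q`_a) (fun a => q`_a) Pa0)
  => a /andP[la ah] a_min.
case: (@arg_maxP _ _ _ a0 (fun a : 'I_(size q) => P q`_a) (fun a => q`_a) Pa0)
  => b /andP[lb bh] b_max.
exists a, b; split=> //; rewrite ltnNge; apply/negP.
  case/(q_hit (fun t => l <= t < q`_a)) => [s t u|m /andP[lm ma]].
    move=> /andP[st tu] /andP[ls _] /andP[_ uh].
    by rewrite (le_trans ls) // (le_lt_trans tu).
  have := a_min m; rewrite /P lm (ltW (lt_le_trans ma ah)) => /(_ isT).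
  by rewrite leNgt ma.
case/(q_hit (fun t => q`_b < t <= h)) => [s t u|m /andP[bm mh]].
  move=> /andP[st tu] /andP[ls _] /andP[_ uh].
  by rewrite (lt_le_trans ls) // (le_trans tu).
have : q`_m <= q`_b by apply: b_max; rewrite /P mh (ltW (le_lt_trans lb bm)).
by rewrite leNgt bm.
Qed.

(** A balanced binary search tree on [q], read level by level.  The function
    [cell v] numbers the cells of level [v] and [center v c] is the value stored
    at the node of cell [c].  An interval that meets [q] descends in the tree
    until the first node whose value it contains; up to that level it lies
    within one cell. *)
Lemma dyadic_cells (R : realType) (L : nat) (q : seq R) :
    sorted <=%R q -> (size q < 2 ^ L)%N ->
  exists (cell : nat -> R -> nat) (center : nat -> nat -> R),
    forall l h, has (fun t => l <= t <= h) q ->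
    exists v : 'I_L, exists c, (forall t, l <= t <= h -> cell v t = c) /\
      l <= center v c <= h.
Proof.
elim: L q => [|L IHL] q q_sorted q_size.
  by exists (fun _ _ => 0%N), (fun _ _ => 0); case: q q_size {q_sorted}.
case: (posnP (size q)) => [/size0nil->|q_gt0].
  by exists (fun _ _ => 0%N), (fun _ _ => 0).
pose n := (size q)./2; pose m := q`_n.
have n_lt : (n < size q)%N by rewrite /n; lia.
have qE : q = take n q ++ m :: drop n.+1 q by rewrite -drop_nth // cat_take_drop.
move: q_sorted; rewrite (sorted_pairwise le_trans) {1}qE pairwise_cat pairwise_cons.
rewrite -!(sorted_pairwise le_trans) allrel_consr => /and3P[/andP[lft _] sl /andP[rgt sr]].
have [|cl [zl Hl]] := IHL _ sl.
  by rewrite size_take n_lt; move: q_size; rewrite expnS /n; lia.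
have [|cr [zr Hr]] := IHL _ sr.
  by rewrite size_drop; move: q_size; rewrite expnS /n; lia.
(* Cell [c] of the left or right subtree becomes cell [2 c] or [2 c + 1] of the
   next level: the parity records the branch taken at the root. *)
exists (fun v t => if v is v'.+1 then
                     if t < m then (cl v' t).*2 else (cr v' t).*2.+1 else 0%N).
exists (fun v c => if v is v'.+1 then
                     if odd c then zr v' c./2 else zl v' c./2 else m).
move=> l h; case m_in : (l <= m <= h).
  by move=> _; exists ord0, 0%N; split=> //=; rewrite m_in.
rewrite {1}qE has_cat /= m_in /= => q_hit.
have [hm|mh] := ltP h m.
  have /Hl[v [c [cellv centv]]] : has (fun t => l <= t <= h) (take n q).
    case/orP: q_hit => // /hasP[t /(allP rgt) mt /andP[_ th]].
    by have := le_lt_trans (le_trans mt th) hm; rewrite ltxx.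
  exists (lift ord0 v), c.*2; split=> [t lth|] /=; last by rewrite odd_double doubleK.
  by case/andP: (lth) => _ th; rewrite (le_lt_trans th hm) cellv.
have {m_in mh} ml : m < l by rewrite ltNge; apply: contraFN m_in => ->.
have /Hr[v [c [cellv centv]]] : has (fun t => l <= t <= h) (drop n.+1 q).
  case/orP: q_hit => // /hasP[t /(allP lft) mt /andP[lt _]].
  by have := lt_le_trans ml (le_trans lt mt); rewrite ltxx.
exists (lift ord0 v), c.*2.+1; split=> [t lth|] /=.
  by case/andP: (lth) => lt _; rewrite ltNge (ltW (lt_le_trans ml lt)) /= cellv.
by rewrite odd_double /= uphalf_double.
Qed.

(** * Weak nets for boxes *)

Lemma card_bigcup_le (J T : finType) (P : pred J) (B : J -> {set T}) :
  (#|\bigcup_(j | P j) B j| <= \sum_(j | P j) #|B j|)%N.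
Proof.
elim/big_rec2: _ => [|j n U _ IH]; first by rewrite cards0.
by apply: leq_trans (leq_card_setU _ _) _; rewrite leq_add2l.
Qed.

(** Within a set [A] of less than [M * g] points, boxes with [g] points can be
    replaced by the [M ^ (2 d)] boxes with quantiles as end points, at the price
    of [2 * g * d] points. *)
Lemma canonical_subboxes {R : realType} {d : nat} {X : finType} (x : X -> 'rV[R]_d)
    (A : {set X}) (g M : nat) :
    (0 < g)%N -> (#|A| < M * g)%N ->
  exists CC : {set {set X}}, (#|CC| <= (M * M) ^ d)%N /\
    forall b : box R d, let Ab := [set i in A | inbox b (x i)] in
      (g <= #|Ab|)%N ->
      exists2 C, C \in CC & C \subset Ab /\ (#|Ab| <= #|C| + 2 * g * d)%N.
Proof.
move=> g_gt0 A_lt.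
have [q qP] := fin_all_exists (fun k => quantiles_exist (fun i => x i 0 k) A g g_gt0).
have q_size k : (size (q k) < M)%N by case: (qP k) => ? _ _; nia.
pose sub (phi : {ffun 'I_d -> 'I_M * 'I_M}) :=
  [set i in A | [forall k, (q k)`_(phi k).1 <= x i 0 k <= (q k)`_(phi k).2]].
exists [set sub phi | phi in {: {ffun 'I_d -> 'I_M * 'I_M}}]; split.
  by apply: leq_trans (leq_imset_card _ _) _; rewrite card_ffun card_prod !card_ord.
move=> b Ab Ab_g.
have /fin_all_exists[phi phiP] : forall k, exists ab : 'I_M * 'I_M,
    [/\ lo b 0 k <= (q k)`_ab.1, (q k)`_ab.2 <= hi b 0 k,
        (#|[set i in A | (lo b 0 k <= x i 0 k < (q k)`_ab.1)%R]| < g)%N &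
        (#|[set i in A | ((q k)`_ab.2 < x i 0 k <= hi b 0 k)%R]| < g)%N].
  move=> k; have [|a1 [a2 Ha]] :=
    quantiles_shrink _ _ _ _ (lo b 0 k) (hi b 0 k) (qP k) g_gt0.
    apply: leq_trans Ab_g _; apply: subset_leq_card; apply/subsetP=> i; rewrite !inE.
    by case/andP=> -> /forallP/(_ k) ->.
  by exists (widen_ord (ltnW (q_size k)) a1, widen_ord (ltnW (q_size k)) a2).
exists (sub [ffun k => phi k]); first by apply/imsetP; exists [ffun k => phi k].
split.
  apply/subsetP=> i; rewrite !inE => /andP[-> /forallP sub_i]; apply/forallP=> k.
  have := sub_i k; rewrite ffunE => /andP[le1 le2]; have [lo1 hi2 _ _] := phiP k.
  by rewrite (le_trans lo1) // (le_trans le2).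
pose lost k := [set i in A | lo b 0 k <= x i 0 k < (q k)`_(phi k).1] :|:
               [set i in A | (q k)`_(phi k).2 < x i 0 k <= hi b 0 k].
have cover : Ab \subset sub [ffun k => phi k] :|: \bigcup_k lost k.
  apply/subsetP=> i; rewrite inE => /andP[iA /forallP ib].
  rewrite finset.in_setU; case isub : (i \in sub _) => //=; move/negbT: isub.
  rewrite inE iA negb_forall => /existsP[k]; rewrite ffunE negb_and -!ltNge => out.
  have /andP[l_i i_h] := ib k.
  apply/bigcupP; exists k => //; rewrite !inE iA l_i i_h !andbT /=.
  exact: out.
apply: leq_trans (subset_leq_card cover) _.
apply: leq_trans (leq_card_setU _ _) _; rewrite leq_add2l.
apply: leq_trans (card_bigcup_le _ _ _ _) _.
rewrite mulnC -[X in (X * _)%N](card_ord d) -sum_nat_const; apply: leq_sum => k _.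
apply: leq_trans (leq_card_setU _ _) _; have [_ _ ? ?] := phiP k; lia.
Qed.

Lemma card_big_blocks {X : finType} (P : {set {set X}}) (m : nat) :
  partition P [set: X] -> (m * #|[set A in P | (m <= #|A|)%N]| <= #|X|)%N.
Proof.
move=> partP; rewrite -cardsT (card_partition partP) mulnC -sum_nat_const.
rewrite big_mkcond [X in (_ <= X)%N]big_mkcond; apply: leq_sum => A _.
by rewrite inE; case: (A \in P) => //=; case: ifP.
Qed.

(** A weak net of size [O(r log log r)] for the boxes that contain [G] points, a
    [1/r] share of all points.  A choice of one level of the search tree in each
    coordinate partitions the points into product cells, and there are
    [Lam = L ^ d] such choices, with [L] of the order of [log r].  By
    [dyadic_cells] a box with [G] points contains the center of a cell that
    holds all points of the box.

    There are at most [r] heavy cells, those with [G * Lam] points or more,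
    over all partitions together, and their centers are put in the net.  In a
    light cell the box is replaced by a canonical subbox; the factor [4 * d.+1]
    in [G] ensures that this keeps half of the [G] points.  The light cells that
    matter contain at least [G] points, so there are at most [r * Lam] of them,
    and all together they have only [r] times a power of [log r] canonical
    subboxes.  Hence [O(r log log r)] greedy
    points leave at most [r] of these subboxes unhit, and each of them receives a
    point of its own. *)
Lemma weak_box_net {R : realType} {d : nat} {X : finType} (x : X -> 'rV[R]_d)
    (r g L e : nat) :
    let G := (4 * d.+1 * g)%N in
    (0 < #|X|)%N -> (0 < g)%N -> (#|X| <= r * G)%N -> (r < 2 ^ L)%N ->
    (L ^ d * ((4 * d.+1 * L ^ d) ^ 2) ^ d <= 2 ^ e)%N ->
  exists P : seq 'rV[R]_d, (size P <= 2 * r * e.+1)%N /\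
    forall b : box R d, (G <= #|[set i | inbox b (x i)]|)%N -> has (inbox b) P.
Proof.
move=> G X_gt0 g_gt0 X_le r_lt Le.
have G_gt0 : (0 < G)%N by rewrite /G; lia.
have r_gt0 : (0 < r)%N by case: (r) X_le => //; lia.
have L_gt0 : (0 < L)%N by case: (L) r_lt => //; lia.
have [q qP] := fin_all_exists (fun k => quantiles_exist (fun i => x i 0 k) setT G G_gt0).
have /fin_all_exists[cell /fin_all_exists[center cellP]] : forall k,
    exists (cell : nat -> R -> nat) (center : nat -> nat -> R),
    forall l h, has (fun t => l <= t <= h) (q k) ->
    exists v : 'I_L, exists c, (forall t, l <= t <= h -> cell v t = c) /\
      l <= center v c <= h.
  move=> k; case: (qP k) => q_size q_sorted _; apply: dyadic_cells => //.
  apply: leq_ltn_trans r_lt; rewrite -(leq_pmul2r G_gt0).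
  by apply: leq_trans X_le; rewrite -cardsT.
pose V := {ffun 'I_d -> 'I_L}.
pose code (v : V) i := [ffun k => cell k (v k) (x i 0 k)].
pose cells (v : V) := preim_partition (code v) [set: X].
have cells_part v : partition (cells v) [set: X] := preim_partitionP _ _.
pose Lam := (L ^ d)%N.
have cardV : #|{: V}| = Lam by rewrite card_ffun !card_ord.
pose occupied (v : V) := [set A in cells v | (G <= #|A|)%N].
pose heavy (v : V) := [set A in cells v | (G * Lam <= #|A|)%N].
have occupied_le v : (#|occupied v| <= r)%N.
  rewrite -(leq_pmul2l G_gt0) [X in (_ <= X)%N]mulnC.
  exact: leq_trans (card_big_blocks _ _ (cells_part v)) X_le.
have heavy_le v : (Lam * #|heavy v| <= r)%N.
  rewrite -(leq_pmul2l G_gt0) [X in (_ <= X)%N]mulnC mulnA.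
  exact: leq_trans (card_big_blocks _ _ (cells_part v)) X_le.
pose mid (v : V) (A : {set X}) : 'rV[R]_d :=
  if [pick i in A] is Some i then \row_k center k (v k) (code v i k) else 0.
pose P1 := [seq mid p.1 p.2 | p <- enum [set p : V * {set X} | p.2 \in heavy p.1]].
(* Each of the [Lam] partitions has at most [r / Lam] heavy cells. *)
have P1_size : (size P1 <= r)%N.
  rewrite size_map -cardE.
  have Lam_gt0 : (0 < Lam)%N by rewrite expn_gt0 L_gt0.
  rewrite -(leq_pmul2l Lam_gt0) -sum1_card.
  have -> : (\sum_(p in [set p : V * {set X} | p.2 \in heavy p.1]) 1 =
    \sum_v #|heavy v|)%N.
    under [RHS]eq_bigr do rewrite -sum1_card.
    by rewrite pair_big_dep /=; apply: eq_bigl => p; rewrite inE.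
  rewrite big_distrr /= -[X in (_ <= X * _)%N]cardV -sum_nat_const.
  by apply: leq_sum => v _.
pose M := (4 * d.+1 * Lam)%N.
have /fin_all_exists[CC CCP] (A : {set X}) : exists CC : {set {set X}},
    (#|A| < M * g)%N -> (#|CC| <= (M * M) ^ d)%N /\
    forall b : box R d, let Ab := [set i in A | inbox b (x i)] in
      (g <= #|Ab|)%N ->
      exists2 C, C \in CC & C \subset Ab /\ (#|Ab| <= #|C| + 2 * g * d)%N.
  case: (ltnP #|A| (M * g)) => [lt|_]; last by exists set0.
  by have [CC HCC] := canonical_subboxes x A g M g_gt0 lt; exists CC.
pose H := \bigcup_v \bigcup_(A in occupied v :\: heavy v)
  [set C in CC A | (#|X| <= 2 * r * #|C|)%N].
have light A v : A \in occupied v :\: heavy v -> (#|A| < M * g)%N.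
  rewrite !inE => /andP[hv /andP[Ac _]]; move: hv; rewrite Ac /= -ltnNge.
  by move/leq_trans; apply; rewrite /G /M; lia.
have H_le : (#|H| <= r * 2 ^ e)%N.
  apply: leq_trans (card_bigcup_le _ _ _ _) _.
  apply: (@leq_trans (\sum_(v : V) r * (M * M) ^ d)).
    apply: leq_sum => v _; apply: leq_trans (card_bigcup_le _ _ _ _) _.
    apply: (@leq_trans (\sum_(A in occupied v :\: heavy v) (M * M) ^ d)).
      apply: leq_sum => A /light/CCP[CC_le _]; apply: leq_trans CC_le.
      by apply: subset_leq_card; apply/subsetP=> C; rewrite inE => /andP[].
    rewrite sum_nat_const leq_mul // (leq_trans _ (occupied_le v)) //.
    by apply: subset_leq_card; exact: subsetDl.
  by rewrite sum_nat_const cardV mulnCA leq_mul2l -[(M * M)%N]/(M ^ 2)%N Le orbT.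
have [|C|S [S_le S_missed]] := greedy_hitting X H (2 * r) e X_gt0; first by lia.
  by case/bigcupP=> v _ /bigcupP[A _]; rewrite inE => /andP[].
pose missed := [set C in H | C :&: S == set0].
have missed_le : (#|missed| <= r)%N.
  have e_gt0 : (0 < 2 ^ e)%N by rewrite expn_gt0.
  by rewrite -(leq_pmul2l e_gt0) [X in (_ <= X)%N]mulnC (leq_trans S_missed).
have [x0 _] := card_gt0P X_gt0.
pose rep (C : {set X}) := odflt x0 [pick i in C].
exists (P1 ++ map x (enum S) ++ [seq x (rep C) | C <- enum missed]); split.
  rewrite !size_cat [size (map x _)]size_map [size (map _ (enum missed))]size_map.
  by rewrite -!cardE; lia.
move=> b b_big.
(* In each coordinate, the level and the cell at which the side of [b] splits. *)
have /fin_all_exists[v /fin_all_exists[c vcP]] : forall k, exists (v : 'I_L) (c : nat),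
    (forall t, lo b 0 k <= t <= hi b 0 k -> cell k v t = c) /\
      lo b 0 k <= center k v c <= hi b 0 k.
  move=> k; apply: cellP; case: (qP k) => _ _; apply.
    move=> s t u /andP[st tu] /andP[ls _] /andP[_ uh].
    by rewrite (le_trans ls) // (le_trans tu).
  apply: leq_trans b_big _; apply: subset_leq_card; apply/subsetP=> i.
  by rewrite !inE => /forallP/(_ k).
have code_b i : inbox b (x i) -> code (finfun v) i = [ffun k => c k].
  move=> /forallP ib; apply/ffunP=> k; rewrite !ffunE.
  by have [cellk _] := vcP k; rewrite cellk.
have /card_gt0P[i0] := leq_trans G_gt0 b_big; rewrite inE => i0b.
pose A := [set j in [set: X] | code (finfun v) i0 == code (finfun v) j].
have A_cell : A \in cells (finfun v) by apply/imsetP; exists i0.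
have Ab : [set i in A | inbox b (x i)] = [set i | inbox b (x i)].
  apply/setP=> i; rewrite !inE /=; case ib : (inbox b (x i)); rewrite ?andbF //.
  by rewrite !code_b // eqxx.
have A_big : (G <= #|A|)%N.
  apply: leq_trans b_big _; rewrite -Ab; apply: subset_leq_card.
  by apply/subsetP=> i; rewrite inE => /andP[].
rewrite !has_cat; case A_heavy : (A \in heavy (finfun v)).
  apply/orP; left; apply/hasP; exists (mid (finfun v) A).
    by apply/mapP; exists (finfun v, A); rewrite // mem_enum inE.
  rewrite /mid; case: pickP => [i|/(_ i0)]; last by rewrite !inE eqxx.
  rewrite !inE => /eqP <-; apply/forallP=> k; rewrite mxE code_b // !ffunE.
  by case: (vcP k).
have A_light : A \in occupied (finfun v) :\: heavy (finfun v).
  by rewrite finset.in_setD A_heavy inE A_cell A_big.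
have [_ /(_ b)] := CCP A (light _ _ A_light); rewrite Ab => /(_ _)[|C C_in [C_sub C_big]].
  by apply: leq_trans b_big; rewrite /G; lia.
have C_H : C \in H.
  apply/bigcupP; exists (finfun v) => //; apply/bigcupP; exists A => //.
  rewrite inE C_in /=; apply: leq_trans X_le _.
  rewrite [(2 * r)%N]mulnC -mulnA leq_mul2l; apply/orP; right.
  have := leq_trans b_big C_big; rewrite /G; nia.
have C_b i : i \in C -> inbox b (x i) by move/(subsetP C_sub); rewrite inE.
apply/orP; right; apply/orP; have [CS|/set0Pn[i]] := eqVneq (C :&: S) set0.
  right; apply/hasP; exists (x (rep C)).
    by apply/mapP; exists C; rewrite // mem_enum inE C_H CS eqxx.
  apply: C_b; rewrite /rep; case: pickP => //= C0.
  have : C = set0 by apply/setP=> i; rewrite C0 inE.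
  move=> C0'; move: C_big; rewrite C0' cards0; lia.
rewrite inE => /andP[iC iS]; left; apply/hasP; exists (x i); last exact: C_b.
by apply/mapP; exists i; rewrite // mem_enum.
Qed.

(** * The covering number *)

Lemma covering_number_le {R : realType} {d : nat} {I : finType} (F : I -> box R d)
    (P : seq 'rV[R]_d) :
  (forall i, has (inbox (F i)) P) -> (covering_number F <= size P)%N.
Proof.
move=> P_hits; rewrite /covering_number; case: ex_minnP => n _ n_min.
apply: (@leq_trans #|` seq_fset tt P|); last by rewrite size_seq_fset size_undup.
apply: n_min; apply/asboolP; exists (seq_fset tt P); split=> // i.
have /hasP[p pP /inboxP Fip] := P_hits i.
have p_in : p \in seq_fset tt P by rewrite seq_fsetE.
by exists p.
Qed.

Lemma matching_number_gt0 {R : realType} {d : nat} {I : finType} (F : I -> box R d)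
  (i : I) : (0 < matching_number F)%N.
Proof.
apply: leq_trans (_ : 1 <= #|[set i]|)%N _; first by rewrite cards1.
apply: (leq_bigmax_cond [set i]); apply/asboolP=> j k /=.
by rewrite !inE => /eqP-> /eqP->.
Qed.

(** The two halves combined: [heavy_point] feeds [multiplicative_weights] with
    [K = 2 ^ d.+1 * nu], whose points meet every box in a [1/(4K)] share, and a
    weak net for [r = 4K] pierces all boxes.  The parameters [L] and [e] stand
    for upper bounds on [log r] and on a multiple of [log log r]. *)
Lemma covering_number_le_net {R : realType} {d : nat} {I : finType}
    (F : I -> box R d) (L e : nat) :
    (forall i j : I, i != j -> (box_set (F i) `&` box_set (F j) !=set0)%classic ->
       intersect_at_corner (F i) (F j)) ->
    let r := (2 ^ d.+3 * matching_number F)%N in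
    (r < 2 ^ L)%N -> (L ^ d * ((4 * d.+1 * L ^ d) ^ 2) ^ d <= 2 ^ e)%N ->
  (covering_number F <= 2 * r * e.+1)%N.
Proof.
move=> F_corner r r_lt Le.
have [I0|/card_gt0P[i0 _]] := posnP #|I|.
  apply: leq_trans (covering_number_le F [::] _) (leq0n _) => i.
  by have := card0_eq I0 i; rewrite inE.
pose K := (2 ^ d.+1 * matching_number F)%N.
have K_gt0 : (0 < K)%N by rewrite muln_gt0 expn_gt0 (matching_number_gt0 F i0).
have rE : r = (4 * K)%N by rewrite /r /K !expnS; lia.
(* The number of points must be a multiple of the block size [4 * d.+1], with
   a factor that exceeds [#|I|]. *)
pose g := #|I|.+1.
have [|x x_heavy] := multiplicative_weights _ I (fun p i => inbox (F i) p) K (4 * d.+1 * g)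
    K_gt0 _ (heavy_point R d I F F_corner); first by rewrite /g; lia.
have X_gt0 : (0 < #|'I_(4 * K * (4 * d.+1 * g))|)%N by rewrite card_ord /g; lia.
have X_le : (#|'I_(4 * K * (4 * d.+1 * g))| <= r * (4 * d.+1 * g))%N.
  by rewrite card_ord rE.
have [P [P_size P_hits]] := weak_box_net x r g L e X_gt0 (ltn0Sn _) X_le r_lt Le.
apply: leq_trans P_size; apply: covering_number_le => i; apply: P_hits; exact: x_heavy.
Qed.

(** * The iterated logarithm *)

Lemma ln2_gt0 {R : realType} : 0 < ln 2 :> R.
Proof. by rewrite ln_gt0 // ltr1n. Qed.

Lemma ler_log2 {R : realType} (x y : R) : 0 < x -> x <= y -> log2 x <= log2 y.
Proof.
move=> x_gt0 xy; rewrite ler_pM2r ?invr_gt0 ?ln2_gt0 //.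
by rewrite ler_ln // posrE // (lt_le_trans x_gt0).
Qed.

Lemma log2_expn {R : realType} (n : nat) : log2 (2 ^ n)%:R = n%:R :> R.
Proof. by rewrite /log2 natrX lnXn // -[(ln _ *+ n)]mulr_natl mulfK // gt_eqF ?ln2_gt0. Qed.

Lemma log2_ge {R : realType} (s : nat) (x : R) : (2 ^ s)%:R <= x -> s%:R <= log2 x.
Proof. by move=> sx; rewrite -[leLHS]log2_expn ler_log2 // ltr0n expn_gt0. Qed.

Lemma loglog_ge {R : realType} (n s : nat) : (2 ^ 2 ^ s <= maxn n 3)%N -> s%:R <= loglog R n.
Proof. by move=> sn; do 2!apply: log2_ge; rewrite ler_nat. Qed.

(** As the argument of [loglog] is at least 3, its least value [loglog R 0] is
    positive, so additive constants can be absorbed in a multiple of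
    [loglog]. *)
Lemma loglog0_gt0 {R : realType} : 0 < loglog R 0.
Proof.
rewrite /loglog max0n divr_gt0 ?ln2_gt0 // ln_gt0 //.
by rewrite ltr_pdivlMr ?ln2_gt0 // mul1r ltr_ln ?posrE ?ltr_nat // ltr0n.
Qed.

Lemma loglog0_le {R : realType} (n : nat) : loglog R 0 <= loglog R n.
Proof.
have log3 : 0 < log2 3 :> R by rewrite divr_gt0 ?ln2_gt0 // ln_gt0 // ltr1n.
by rewrite ler_log2 // ler_log2 ?ltr0n // ler_nat leq_max leqnn orbT.
Qed.

(** * The theorem *)

Local Open Scope classical_set_scope.

Theorem theorem1p6 (R : realType) (d : nat) :
  exists c : R, forall (I : finType) (F : I -> box R d),
    (forall i j : I, i != j -> box_set (F i) `&` box_set (F j) !=set0 ->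
       intersect_at_corner (F i) (F j)) ->
    (covering_number F)%:R <=
      c * (matching_number F)%:R * loglog R (matching_number F).
Proof.
pose A := (d * (1 + 2 * d) * (d + 6) + 2 * d * (d + 2) + 1)%N.
exists ((2 * 2 ^ d.+3 * A)%:R * (1 + (loglog R 0)^-1)) => I F F_corner.
set nu := matching_number F.
pose t := trunc_log 2 (maxn nu 3); pose s := trunc_log 2 t.
have t_gt0 : (0 < t)%N by rewrite trunc_log_gt0 /=; lia.
have t_le : (2 ^ t <= maxn nu 3)%N by apply: trunc_logP; lia.
have nu_lt : (nu < 2 ^ t.+1)%N.
  by apply: leq_ltn_trans (trunc_log_ltn _ _) => //; rewrite leq_maxl.
have s_le : (2 ^ s <= t)%N by apply: trunc_logP.
have t_lt : (t < 2 ^ s.+1)%N by apply: trunc_log_ltn.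
have s_loglog : s%:R <= loglog R nu.
  by apply: loglog_ge; apply: leq_trans t_le; rewrite leq_exp2l.
pose L := (d + 4 + t)%N; pose l := (d + 6 + s)%N.
pose e := (d * l + (d + 2 + d * l) * 2 * d)%N.
have r_lt : (2 ^ d.+3 * nu < 2 ^ L)%N.
  have -> : L = (d.+3 + t.+1)%N by rewrite /L; lia.
  by rewrite expnD ltn_pmul2l // expn_gt0.
have L_le : (L <= 2 ^ l)%N.
  have -> : (2 ^ l = 2 ^ (d + 5) * 2 ^ s.+1)%N.
    by rewrite -expnD; congr (_ ^ _)%N; rewrite /l; lia.
  have := leq_mul (ltnW (ltn_expl (d + 5) (ltnSn 1))) (ltnW t_lt); rewrite /L; nia.
have Ld_le : (L ^ d <= 2 ^ (d * l))%N.
  by case: (posnP d) => [->|d_gt0]; rewrite // mulnC expnM leq_exp2r.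
(* This choice of [e] is linear in [s], that is in [log log nu]. *)
have Le : (L ^ d * ((4 * d.+1 * L ^ d) ^ 2) ^ d <= 2 ^ e)%N.
  have M_le : (4 * d.+1 * L ^ d <= 2 ^ (d + 2 + d * l))%N.
    rewrite !expnD leq_mul // mulnC leq_mul // ltn_expl //.
  rewrite /e expnD leq_mul // !expnM.
  case: (posnP d) => [->//|d_gt0]; rewrite leq_exp2r // leq_exp2r //.
have := covering_number_le_net F L e F_corner r_lt Le; rewrite -/nu => tau_le.
have e_le : (e.+1 <= A * (s + 1))%N.
  have : (d * (1 + 2 * d) * s <= A * s)%N by rewrite leq_mul2r /A; lia.
  by rewrite /e /l mulnDr muln1 {2}/A; lia.
have {}tau_le : (covering_number F <= 2 * 2 ^ d.+3 * A * nu * (s + 1))%N.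
  apply: leq_trans tau_le _; apply: leq_trans (leq_mul (leqnn _) e_le) _.
  by rewrite [X in (X <= _)%N]mulnA [(2 * (_ * nu))%N]mulnA (mulnAC _ nu A).
have := tau_le; rewrite -(ler_nat R) => /le_trans; apply.
rewrite [X in X <= _]natrM [X in X * _ <= _]natrM -!mulrA ler_wpM2l //.
rewrite mulrCA ler_wpM2l // natrD mulrDl mul1r lerD //.
by rewrite mulrC ler_pdivlMr ?loglog0_gt0 // mul1r loglog0_le.
Qed.
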